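(* Consider a fixed finite-sized bandit tree (as defined in the context) with binary-reward leaf nodes. Suppose that each leaf has a true win rate $\mu^*$ with $0<\mu^*<1$, that the prior probability distribution at each leaf is strictly positive on $(0,1)$ and has bounded derivatives, and that no two sibling nodes have exactly identical minimax values. Suppose that samples are chosen by the Bayes-UCT2 sampling policy: at each interior node, descend to the child $i$ that maximizes $B_i=\mu_i+\sqrt{2\ln N}\,\sigma_i$ (notation as in the context). Then, as the total number of trials tends to infinity, all interior nodes converge with probability $1$ to their correct minimax optimal point values; that is, the posterior distribution at every interior node converges with probability $1$ to a delta function at the minimax value of that node.
   Context: Bandit tree: a finite rooted tree (no loops or duplicate nodes, with a fixed set of leaves) in which every interior (non-leaf) node is designated either a MAX node or a MIN node. Each leaf is a bandit arm that, each time it is sampled, gives a payoff in $\{0,1\}$, equal to $1$ with a fixed probability (its true win rate) $\mu^*$. Payoffs at different leaves are uncorrelated (independent), and successive payoffs of one leaf are independent. Minimax value: the minimax value of a leaf is its true win rate; the minimax value of a MAX (respectively MIN) node is the maximum (respectively minimum) of the minimax values of its children. Leaf posteriors: each leaf has a prior probability density on $(0,1)$ for its win rate. After $W$ payoffs equal to $1$ and $L$ payoffs equal to $0$ have been observed at a leaf with prior density $f$, its posterior distribution has density proportional to $p^{W}(1-p)^{L}f(p)$. Interior node posteriors: computed recursively from the leaves upward, treating the distributions of sibling nodes as independent. If the children of a node have distributions with cumulative distribution functions $C_i$, the distribution of the node has cumulative distribution function $\prod_i C_i(x)$ if it is a MAX node, and $1-\prod_i(1-C_i(x))$ if it is a MIN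 node. Sampling policy notation: each trial starts at the root and descends through the tree, choosing one child at each interior node, until it reaches a leaf, which is then sampled; the posteriors are then recomputed. At an interior node with children indexed by $i$, $n_i$ is the number of previous trials of child $i$, $N=\sum_i n_i$, and $\mu_i$ and $\sigma_i$ are the mean and the standard deviation (square root of the variance) of the current posterior distribution of child $i$. The same rule of maximizing $B_i$ is used at every interior node. The choice is arbitrary when $N=0$ (where $B_i$ is not defined) and when there are ties. *)

(* Defs.v *)
From HB Require Import structures.
From mathcomp Require Import all_boot all_order all_algebra.
From mathcomp Require Import all_classical all_reals all_analysis.
From mathcomp Require Import measurable_realfun.

Set Implicit Arguments.
Unset Strict Implicit.
Unset Printing Implicit Defensive.

Import Order.TTheory GRing.Theory Num.Theory.
Import numFieldNormedType.Exports.

Local Open Scope classical_set_scope.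
Local Open Scope ring_scope.

Section leaf_posterior.
Context (R : realType).

Record prior := Prior {
  density :> R -> R ;
  density_measurable : measurable_fun (`]0, 1[%classic : set R) density ;
  density_ge0 : forall p, 0 < p < 1 -> 0 <= density p ;
  density_integral :
    (\int[lebesgue_measure]_(p in `]0%R, 1%R[) (density p)%:E = 1)%E }.

Variables (f : prior) (W L : nat).

Definition unnormalized_posterior (A : set (measurableTypeR R)) : \bar R :=
  (\int[lebesgue_measure]_(p in A `&` `]0%R, 1%R[)
     (p ^+ W * (1 - p) ^+ L * f p)%:E)%E.

Let post_ge0 (A : set R) p : (A `&` `]0, 1[%classic) p ->
  (0 <= (p ^+ W * (1 - p) ^+ L * f p)%:E)%E.
Proof.
rewrite /= in_itv/= => -[_ p01]; rewrite lee_fin !mulr_ge0 ?density_ge0//.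
  by rewrite exprn_ge0// ltW//; case/andP: p01.
by rewrite exprn_ge0// subr_ge0 ltW//; case/andP: p01.
Qed.

Let unnormalized0 : unnormalized_posterior set0 = 0%E.
Proof. by rewrite /unnormalized_posterior set0I integral_set0. Qed.

Let unnormalized_ge0 A : (0 <= unnormalized_posterior A)%E.
Proof. by apply: integral_ge0 => p; exact: post_ge0. Qed.

Let unnormalized_sigma_additive : semi_sigma_additive unnormalized_posterior.
Proof.
move=> /= F mF tF mUF; apply: cvg_toP.
  apply: ereal_nondecreasing_is_cvgn => m n mn.
  by apply: lee_sum_nneg_natr => // k _ _; exact: unnormalized_ge0.
rewrite /unnormalized_posterior setI_bigcupl ge0_integral_bigcup//=.
- by move=> k; apply: measurableI => //; exact: mF.
- have mw : measurable_fun (`]0, 1[%classic : set R)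
      (fun p : R => p ^+ W * (1 - p) ^+ L * f p).
    apply: measurable_funM; last exact: density_measurable.
    apply: measurable_funM; apply: measurable_funX => //.
    exact: measurable_funB.
  apply/measurable_EFinP; apply: measurable_funS mw => //.
  by move=> x [k _ []].
- by move=> p [k _]; exact: post_ge0.
- apply/trivIsetP => i j _ _ ij; rewrite setIACA.
  by have /trivIsetP/(_ i j I I ij) -> := tF; rewrite set0I.
Qed.

HB.instance Definition _ := isMeasure.Build _ _ _ unnormalized_posterior
  unnormalized0 unnormalized_ge0 unnormalized_sigma_additive.

(* The total mass of [unnormalized_posterior] is positive and finite because
   [f] is a density on ]0, 1[, so the fallback argument of [mnormalize] is never
   used. *)
Definition leaf_posterior : probability (measurableTypeR R) R :=
  mnormalize unnormalized_posterior (dirac (0 : measurableTypeR R)).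

End leaf_posterior.

Inductive player := Max | Min.

Section distribution_function.
Context (R : realType) (mu : probability (measurableTypeR R) R).

Definition dist_fun (x : R) : R := fine (mu `]-oo, x]%classic).

Let idTR : measurableTypeR R -> R := idfun.

#[local] HB.instance Definition _ :=
  @isMeasurableFun.Build _ _ _ _ idTR (@measurable_id _ _ setT).

Let dist_funE : dist_fun = fine \o cdf (idTR : {RV mu >-> R}).
Proof. by []. Qed.

Lemma dist_fun_nd : nondecreasing dist_fun.
Proof.
move=> x y xy; rewrite dist_funE /= fine_le ?fin_num_measure//.
exact: cdf_nondecreasing.
Qed.

Lemma dist_fun_rc : right_continuous dist_fun.
Proof.
move=> a; rewrite dist_funE; apply: fine_cvg.
by rewrite fineK ?fin_num_measure//; exact: cdf_right_continuous.
Qed.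

Lemma dist_funNy : dist_fun @ -oo --> (0 : R).
Proof. by rewrite dist_funE; exact/fine_cvg/cvg_cdfNy0. Qed.

Lemma dist_funy : dist_fun @ +oo --> (1 : R).
Proof. by rewrite dist_funE; exact/fine_cvg/cvg_cdfy1. Qed.

Lemma dist_fun_ge0 x : 0 <= dist_fun x.
Proof. by rewrite fine_ge0. Qed.

Lemma dist_fun_le1 x : dist_fun x <= 1.
Proof.
by rewrite -lee_fin fineK ?fin_num_measure// probability_le1.
Qed.

End distribution_function.

Section node_posterior.
Context (R : realType) (k : player) (n : nat).
Variable mu : 'I_n.+1 -> probability (measurableTypeR R) R.

Definition node_cdf (x : R) : R :=
  match k with
  | Max => \prod_(i < n.+1) dist_fun (mu i) x
  | Min => 1 - \prod_(i < n.+1) (1 - dist_fun (mu i) x)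
  end.

Let node_cdf_nd : nondecreasing node_cdf.
Proof.
move=> x y xy; rewrite /node_cdf; case: k.
  by apply: ler_prod => i _; rewrite dist_fun_ge0 dist_fun_nd.
rewrite lerD2l lerN2; apply: ler_prod => i _.
by rewrite subr_ge0 dist_fun_le1 lerD2l lerN2 dist_fun_nd.
Qed.

Let prod_cvg (T : Type) (F : set_system T) (FF : Filter F)
    (g : 'I_n.+1 -> T -> R) (l : 'I_n.+1 -> R) :
  (forall i, g i x @[x --> F] --> l i) ->
  \prod_(i < n.+1) g i x @[x --> F] --> \prod_(i < n.+1) l i.
Proof. by move=> gl; apply: cvg_big => //; exact: mul_continuous. Qed.

Let node_cdf_rc : right_continuous node_cdf.
Proof.
move=> a; rewrite /node_cdf; case: k.
  by apply: prod_cvg => i; exact: dist_fun_rc.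
apply: cvgB; first exact: cvg_cst.
by apply: prod_cvg => i; apply: cvgB; [exact: cvg_cst|exact: dist_fun_rc].
Qed.

HB.instance Definition _ :=
  isCumulative.Build R _ R node_cdf node_cdf_nd node_cdf_rc.

Let node_cdfNy : node_cdf @ -oo --> (0 : R).
Proof.
rewrite /node_cdf; case: k.
  rewrite [X in _ --> X](_ : 0 = \prod_(i < n.+1) (0 : R)).
    by apply: prod_cvg => i; exact: dist_funNy.
  by rewrite big_ord_recl mul0r.
rewrite [X in _ --> X](_ : 0 = 1 - \prod_(i < n.+1) (1 - 0 : R)).
  apply: cvgB; first exact: cvg_cst.
  by apply: prod_cvg => i; apply: (cvgB (cvg_cst _)); exact: dist_funNy.
by rewrite subr0 big1_eq subrr.
Qed.

Let node_cdfy : node_cdf @ +oo --> (1 : R).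
Proof.
rewrite /node_cdf; case: k.
  rewrite [X in _ --> X](_ : 1 = \prod_(i < n.+1) (1 : R)).
    by apply: prod_cvg => i; exact: dist_funy.
  by rewrite big1_eq.
rewrite [X in _ --> X](_ : 1 = 1 - \prod_(i < n.+1) (1 - 1 : R)).
  apply: cvgB; first exact: cvg_cst.
  by apply: prod_cvg => i; apply: (cvgB (cvg_cst _)); exact: dist_funy.
by rewrite subrr big_ord_recl mul0r subr0.
Qed.

HB.instance Definition _ :=
  isCumulativeBounded.Build R 0 1 node_cdf node_cdfNy node_cdfy.

(* The probability measure whose distribution function is [node_cdf], see
   [cdf_lebesgue_stieltjes_id]. *)
Definition node_posterior : probability (measurableTypeR R) R :=
  lebesgue_stieltjes_measure node_cdf.

End node_posterior.

Inductive tree (R : realType) :=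
| Leaf (f : prior R) (win_rate : R)
| Node (k : player) (n : nat) (child : 'I_n.+1 -> tree R).
Arguments Node {R} k n child.

(* Positions of the leaves and of the interior nodes of a tree: a path is a
   child index followed by a path in that child, and [None] is the root. *)
Fixpoint leaf (R : realType) (t : tree R) : finType :=
  match t with
  | Leaf _ _ => unit
  | Node _ n c => {i : 'I_n.+1 & leaf (c i)}
  end.

Fixpoint interior_node (R : realType) (t : tree R) : finType :=
  match t with
  | Leaf _ _ => void
  | Node _ n c => option {i : 'I_n.+1 & interior_node (c i)}
  end.

Fixpoint leaf_prior (R : realType) (t : tree R) : leaf t -> prior R :=
  match t with
  | Leaf f _ => fun=> f
  | Node _ _ _ => fun l => leaf_prior (tagged l)
  end.

Fixpoint win_rate (R : realType) (t : tree R) : leaf t -> R :=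
  match t with
  | Leaf _ m => fun=> m
  | Node _ _ _ => fun l => win_rate (tagged l)
  end.

Fixpoint subtree (R : realType) (t : tree R) : interior_node t -> tree R :=
  match t with
  | Leaf _ _ => fun v => match v : void with end
  | Node k n c => fun v =>
      if v is Some u then subtree (tagged u) else Node k n c
  end.

Fixpoint subtree_leaf (R : realType) (t : tree R) :
    forall v : interior_node t, leaf (subtree v) -> leaf t :=
  match t return forall v : interior_node t, leaf (subtree v) -> leaf t with
  | Leaf _ _ => fun v => match v : void with end
  | Node k n c => fun v =>
      match v return leaf (@subtree R (Node k n c) v) -> leaf (Node k n c) with
      | Some u => fun l =>
          Tagged (fun i => leaf (c i)) (@subtree_leaf R (c (tag u)) (tagged u) l)
      | None => fun l => l
      end
  end.

Fixpoint minimax (R : realType) (t : tree R) : R :=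
  match t with
  | Leaf _ m => m
  | Node Max n c =>
      \big[Num.max/minimax (c ord0)]_(i < n.+1) minimax (c i)
  | Node Min n c =>
      \big[Num.min/minimax (c ord0)]_(i < n.+1) minimax (c i)
  end.

Fixpoint distinct_siblings (R : realType) (t : tree R) : Prop :=
  match t with
  | Leaf _ _ => True
  | Node _ n c => injective (fun i => minimax (c i)) /\
                  forall i, distinct_siblings (c i)
  end.

(* Observations: the numbers of payoffs 1 and 0 received so far at each leaf. *)
Definition counts (R : realType) (t : tree R) := leaf t -> nat * nat.

Definition child_counts (R : realType) k n (c : 'I_n.+1 -> tree R)
    (s : counts (Node k n c)) (i : 'I_n.+1) : counts (c i) :=
  fun l => s (Tagged (fun i => leaf (c i)) l).
Arguments child_counts {R k n c} s i l.

Definition node_counts (R : realType) (t : tree R) (s : counts t)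
    (v : interior_node t) : counts (subtree v) :=
  fun l => s (subtree_leaf l).
Arguments node_counts {R t} s v l.

Fixpoint posterior (R : realType) (t : tree R) :
    counts t -> probability (measurableTypeR R) R :=
  match t return counts t -> probability (measurableTypeR R) R with
  | Leaf f _ => fun s => leaf_posterior f (s tt).1 (s tt).2
  | Node k n c => fun s =>
      node_posterior k (fun i => posterior (child_counts s i))
  end.

Definition mean (R : realType) (mu : probability (measurableTypeR R) R) : R :=
  fine 'E_mu[idfun].

Definition stddev (R : realType) (mu : probability (measurableTypeR R) R) : R :=
  Num.sqrt (fine 'V_mu[idfun]).

(* Every trial of a node samples exactly one leaf below it. *)
Definition trials (R : realType) (t : tree R) (s : counts t) : nat :=
  \sum_(l : leaf t) ((s l).1 + (s l).2).

Definition bayes_uct2_score (R : realType) k n (c : 'I_n.+1 -> tree R)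
    (s : counts (Node k n c)) (i : 'I_n.+1) : R :=
  let N := (\sum_(j < n.+1) trials (child_counts s j))%N in
  let mu := posterior (child_counts s i) in
  mean mu + Num.sqrt (2 * ln N%:R) * stddev mu.

(* [bayes_uct2 s l]: given the observations [s], descending from the root to the
   leaf [l] obeys the policy; when [N = 0] or in case of ties any choice does. *)
Fixpoint bayes_uct2 (R : realType) (t : tree R) : counts t -> leaf t -> Prop :=
  match t with
  | Leaf _ _ => fun _ _ => True
  | Node k n c => fun s l =>
      ((0 < \sum_(j < n.+1) trials (child_counts s j))%N ->
         forall j, bayes_uct2_score s j <= bayes_uct2_score s (tag l)) /\
      bayes_uct2 (child_counts s (tag l)) (tagged l)
  end.

(* [x l j] is the payoff of the [j]-th sample of the leaf [l], and [a m] is the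
   leaf sampled by the [m]-th trial; [observed x a m] are the observations
   available before that trial. *)
Definition observed (R : realType) (t : tree R) (x : leaf t -> nat -> bool)
    (a : nat -> leaf t) (m : nat) : counts t :=
  fun l => let v := (\sum_(j < m) (a j == l))%N in
           ((\sum_(j < v) x l j)%N, (\sum_(j < v) ~~ x l j)%N).

Definition mutually_independent (R : realType) d d' (T : measurableType d)
    (T' : measurableType d') (P : probability T R) (I : eqType)
    (X : I -> {RV P >-> T'}) : Prop :=
  forall (J : seq I) (B : I -> set T'),
    uniq J -> (forall i, measurable (B i)) ->
    P (\bigcap_(i in [set` J]) (X i @^-1` B i)) =
    (\prod_(i <- J) P (X i @^-1` B i))%E.

Definition weak_cvg (R : realType)
    (mu_ : nat -> probability (measurableTypeR R) R)
    (mu : probability (measurableTypeR R) R) : Prop :=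
  forall h : R -> R, continuous h -> (exists M, forall x, `|h x| <= M) ->
    (\int[mu_ m]_x (h x)%:E)%E @[m --> \oo] --> (\int[mu]_x (h x)%:E)%E.

(* Main.v *)
Require Import Defs.
From mathcomp Require Import all_boot all_order all_algebra.
From mathcomp Require Import all_classical all_reals all_analysis.
From mathcomp Require Import measurable_realfun ring lra.

Set Implicit Arguments.
Unset Strict Implicit.
Unset Printing Implicit Defensive.

Import Order.TTheory GRing.Theory Num.Theory.
Import numFieldNormedType.Exports.

Local Open Scope classical_set_scope.
Local Open Scope ring_scope.

(* Win frequencies converge almost surely (exponential moments and
   Borel-Cantelli), so on almost every run the posterior of a leaf concentrates
   at its win rate as soon as the leaf is sampled infinitely often: moving [p]
   away from the observed frequency costs an exponential factor in the
   likelihood.  Concentration goes up the tree because the distribution function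
   of a Max node is the product of those of its children, and dually for Min.

   The policy samples every leaf infinitely often, by induction on the tree.  If
   a child were tried finitely often, its posterior would be frozen with a
   standard deviation [s > 0]; a sibling tried infinitely often has, by
   induction, a concentrated posterior, hence a standard deviation eventually
   below [s / 2].  All means lie in [0, 1], so the exploration term [sqrt (2 ln N)]
   makes the frozen child win every comparison with that sibling from some time
   on, and the sibling would not be tried any more. *)

(** * Almost sure convergence of the win frequencies *)

Section frequency.
Context (R : realType) (d : measure_display) (T : measurableType d).
Context (P : probability T R).

Section upper_tail.
Variables (E : nat -> set T) (p : R).
Hypothesis mE : forall j, measurable (E j).
Hypothesis indepE : forall J : seq nat, uniq J ->
  P (\bigcap_(j in [set` J]) E j) = (p ^+ size J)%:E.

(* Expanding the first factor of the product moves its event into the domain of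
   integration. *)
Lemma integral_prod_indep (c : R) (s J : seq nat) : 0 <= c -> uniq (J ++ s) ->
  (\int[P]_(w in \bigcap_(j in [set` J]) E j)
     (\prod_(j <- s) (1 + c * \1_(E j) w))%:E =
   (p ^+ size J * (1 + c * p) ^+ size s)%:E)%E.
Proof.
move=> c0; elim: s J => [|h s IH] J uJs.
  under eq_integral do rewrite big_nil.
  rewrite integral_cst; last by apply: bigcap_measurableType => j _; exact: mE.
  rewrite mulr1 mul1e; apply: indepE; move: uJs; rewrite cats0//.
have mf k : measurable_fun setT (fun w => 1 + c * \1_(E k) w : R).
  by apply: measurable_funD => //; apply: measurable_funM.
have mprod D : measurable_fun D
    (fun w => (\prod_(j <- s) (1 + c * \1_(E j) w))%:E).
  apply: (@measurable_funS _ _ _ _ setT) => //.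
  by apply/measurable_EFinP; apply: measurable_prod => k _; exact: mf.
have prod0 w : 0 <= \prod_(j <- s) (1 + c * \1_(E j) w).
  by apply: prodr_ge0 => k _; rewrite addr_ge0// mulr_ge0.
have mJ : measurable (\bigcap_(j in [set` J]) E j).
  by apply: bigcap_measurableType => j _; exact: mE.
pose G w := \prod_(j <- s) (1 + c * \1_(E j) w).
rewrite (eq_integral (fun w => (G w)%:E + c%:E * (\1_(E h) w * G w)%:E)%E).
have mhG : measurable_fun (\bigcap_(j in [set` J]) E j)
    (fun w => (\1_(E h) w * G w)%:E).
  rewrite (_ : (fun _ => _) = (fun w => (\1_(E h) w)%:E * (G w)%:E)%E)//.
  by apply: emeasurable_funM => //; apply/measurable_EFinP.
rewrite ge0_integralD//; last first.
- exact: measurable_funeM.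
- by move=> w _; rewrite -EFinM lee_fin !mulr_ge0//; exact: prod0.
- by move=> w _; rewrite lee_fin; exact: prod0.
rewrite ge0_integralZl_EFin//; last first.
  by move=> w _; rewrite lee_fin mulr_ge0//; exact: prod0.
have -> : (\int[P]_(x in \bigcap_(j in [set` J]) E j)
   (\1_(E h) x * G x)%:E =
   \int[P]_(x in \bigcap_(j in [set` h :: J]) E j)
     (G x)%:E)%E.
  have -> : \bigcap_(j in [set` h :: J]) E j =
      (\bigcap_(j in [set` J]) E j) `&` E h.
    rewrite setIC -bigcap_setU1; congr bigcap; apply/seteqP; split => j /=.
      by rewrite inE => /orP[/eqP ->|]; [left|right].
    by case=> [->|jJ]; rewrite inE ?eqxx// jJ orbT.
  rewrite integral_mkcondr; apply: eq_integral => w _.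
  by rewrite patchE indicE; case: ifPn => _; rewrite ?mul1r ?mul0r.
rewrite /G !IH/=.
- by rewrite -EFinM -EFinD; congr EFin; rewrite !exprS; ring.
- by move: uJs; rewrite -[h :: s]cat1s uniq_catCA => /andP[].
- by move: uJs; rewrite -[h :: s]cat1s uniq_catCA.
- by move=> w _; rewrite big_cons mulrDl mul1r -mulrA EFinD EFinM.
Qed.

Lemma upper_frequency (e : R) : 0 < p < 1 -> 0 < e ->
  {ae P, forall w : T,
    \forall n \near \oo, \sum_(j < n) \1_(E j) w < n%:R * (p + e) :> R}.
Proof.
move=> /andP[p0 p1] e0.
(* Markov's inequality for [(1 + e) ^ (sum)]: the base [1 + e] gives a rate
   [r < 1] because [e / (1 + e) <= ln (1 + e)]. *)
pose s := ln (1 + e).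
have s0 : 0 < s by rewrite ln_gt0// ltrDl.
pose b := expR (- (s * (p + e))).
pose r := (1 + e * p) * b.
pose F n := [set w | n%:R * (p + e) <= \sum_(j < n) \1_(E j) w :> R].
(* [Y n] is the exponential of [s] times the excess of the sum over [n (p + e)]: at least 1 on
   [F n], and of expectation [r ^+ n] by independence. *)
pose Y n w := \prod_(j <- iota 0 n) (1 + e * \1_(E j) w) * b ^+ n.
have YE n w : Y n w = expR (s * (\sum_(j < n) \1_(E j) w - n%:R * (p + e))).
  rewrite /Y -[n in iota 0 n]subn0 big_mkord mulrBr expRD; congr (_ * _).
    rewrite mulr_sumr expR_sum; apply: eq_bigr => j _.
    rewrite indicE; case: (_ \in _); rewrite ?mulr1 ?mulr0 ?expR0 ?addr0//.
    by rewrite lnK// posrE addr_gt0.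
  by rewrite /b -expRM_natl; congr expR; ring.
have m1 (n : nat) : measurable_fun setT (fun w => \sum_(j < n) \1_(E j) w : R).
  by apply: measurable_sum => j; exact: measurable_indic.
have mY n : measurable_fun setT (Y n).
  rewrite (_ : Y n = fun w => expR (s * (\sum_(j < n) \1_(E j) w - n%:R * (p + e)))).
    apply: measurableT_comp => //; apply: measurable_funM => //.
    by apply: measurable_funB => //.
  by apply/funext => w; exact: YE.
have mF n : measurable (F n).
  rewrite (_ : F n = (fun w => \sum_(j < n) \1_(E j) w) @^-1` `[n%:R * (p + e), +oo[%classic).
    by rewrite -[X in measurable X]setTI; exact: m1.
  by apply/seteqP; split => w; rewrite /F/= in_itv/= andbT.
have iY n : (\int[P]_w (Y n w)%:E = (r ^+ n)%:E)%E.
  have := integral_prod_indep (s := iota 0 n) (J := [::]) (ltW e0) (iota_uniq _ _).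
  rewrite set_nil bigcap_set0 size_iota expr0 mul1r /Y => iE.
  rewrite (eq_integral (fun w => (b ^+ n)%:E *
    (\prod_(j <- iota 0 n) (1 + e * \1_(E j) w))%:E)%E); last first.
    by move=> w _; rewrite -EFinM mulrC.
  rewrite ge0_integralZl_EFin ?iE//.
  - by rewrite -EFinM /r exprMn mulrC.
  - by move=> w _; rewrite lee_fin; apply: prodr_ge0 => j _; rewrite addr_ge0// mulr_ge0// ltW.
  - apply/measurable_EFinP; apply: measurable_prod => j _.
    by apply: measurable_funD => //; apply: measurable_funM.
  - by rewrite exprn_ge0// expR_ge0.
have PF n : (P (F n) <= (r ^+ n)%:E)%E.
  rewrite -iY -[F n]setIT -integral_indic//; apply: ge0_le_integral => //.
  - by apply/measurable_EFinP; exact: measurable_indic.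
  - exact/measurable_EFinP.
  - move=> w _; rewrite lee_fin indicE YE.
    have [Fw|nFw] := pselect (F n w); last by rewrite memNset// expR_ge0.
    by rewrite mem_set// -[leLHS]expR0 ler_expR mulr_ge0 ?subr_ge0// ltW.
have r0 : 0 <= r by rewrite mulr_ge0 ?expR_ge0// addr_ge0// ltW// mulr_gt0.
(* Since [1 + e p <= exp (e p)], it is enough that [e p < s (p + e)]. With the lower bound
   [e / (1 + e)] for [s] this reads [p (1 + e) < p + e], that is, [p < 1]. *)
have r1 : r < 1.
  rewrite /r /b expRN ltr_pdivrMr ?expR_gt0// mul1r.
  apply: (@le_lt_trans _ _ (expR (e * p))); first exact: expR_ge1Dx.
  rewrite ltr_expR.
  have es : e / (1 + e) <= s.
    have /(@le_ln1Dx R) : -1 < - (e / (1 + e)).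
      by rewrite ltrN2 ltr_pdivrMr ?mul1r ?ltrDr// addr_gt0.
    have -> : 1 + - (e / (1 + e)) = (1 + e)^-1 by field; rewrite gt_eqF// addr_gt0.
    by rewrite lnV ?lerN2// posrE addr_gt0.
  apply: (@lt_le_trans _ _ (e / (1 + e) * (p + e))); last first.
    by rewrite ler_wpM2r// addr_ge0 ?ltW.
  rewrite -mulrA ltr_pM2l// mulrC ltr_pdivlMr ?addr_gt0//.
  by rewrite mulrDr mulr1 ltrD2l gtr_pMl.
(* The geometric bound makes the probabilities summable, so Borel-Cantelli applies. *)
have sumF : (\sum_(n <oo) P (F n) < +oo)%E.
  apply: (@le_lt_trans _ _ (\sum_(n <oo) (r ^+ n)%:E)%E).
    by apply: lee_nneseries => // n _; exact: PF.
  rewrite (_ : (fun _ => _) = EFin \o series (geometric 1 r)); last first.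
    by apply/funext => n; rewrite /= /series/= -sumEFin; apply: eq_bigr => k _; rewrite mul1r.
  by rewrite EFin_lim ?ltry//; apply: is_cvg_geometric_series; rewrite ger0_norm.
exists (lim_sup_set F); split.
- by apply: bigcap_measurableType => n _; exact: bigcup_measurable.
- exact: lim_sup_set_cvg0.
move=> w /= nw n _; apply: contrapT => nF; apply: nw; exists n => // k /= nk.
rewrite ltNge; apply/negP => Fk; apply: nF; by exists k.
Qed.
End upper_tail.

(** The upper bound is used twice: on the payoffs 1 with [p], and on the payoffs 0 with [1 - p],
    which bounds the frequency of the payoffs 1 from below. *)
Lemma strong_law_bernoulli (X : nat -> {RV P >-> bool}) (p : R) : 0 < p < 1 ->
  mutually_independent X ->
  (forall j, P (X j @^-1` [set true]) = p%:E) ->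
  {ae P, forall w : T,
    (\sum_(j < n) X j w)%:R / n%:R @[n --> \oo] --> p}.
Proof.
move=> /andP[p0 p1] indep Xp.
have mE b j : measurable (X j @^-1` [set b]) by rewrite -[_ @^-1` _]setTI; exact: measurable_funPT.
have XNp j : P (X j @^-1` [set false]) = (1 - p)%:E.
  rewrite (_ : _ @^-1` _ = ~` (X j @^-1` [set true])); last first.
    by apply/seteqP; split => w /=; case: (X j w).
  by rewrite probability_setC// Xp.
have indepb b q (J : seq nat) : (forall j, P (X j @^-1` [set b]) = q%:E) -> uniq J ->
    P (\bigcap_(j in [set` J]) (X j @^-1` [set b])) = (q ^+ size J)%:E.
  move=> Xq uJ; rewrite (indep J (fun=> [set b]))//.
  by rewrite (eq_bigr _ (fun j _ => Xq j)) prodEFin big_const_seq count_predT iter_mulr_1.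
(* Countably many tolerances suffice, and their exceptional null sets can be united. *)
pose e k : R := k.+1%:R^-1.
have tail b q : 0 < q < 1 -> (forall j, P (X j @^-1` [set b]) = q%:E) ->
    {ae P, forall w, forall k, \forall n \near \oo,
      \sum_(j < n) \1_(X j @^-1` [set b]) w < n%:R * (q + e k)}.
  move=> q01 Xq; apply: ae_foralln => k.
  apply: (@upper_frequency (fun j => X j @^-1` [set b]) q) => //.
    by move=> J; exact: indepb.
  by rewrite invr_gt0.
have Np01 : 0 < 1 - p < 1 by lra.
have := tail false _ Np01 XNp; have := tail true p _ Xp.
rewrite p0 p1 => /(_ isT).
apply: filterS2 => w upper lower; apply/cvgrPdist_le => /= eps eps0.
have [k ke] : exists k, e k < eps.
  have [k _ /(_ k (leqnn k)) ke] := near_infty_natSinv_lt (PosNum eps0).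
  by exists k.
near=> n.
have n0 : 0 < n%:R :> R by rewrite ltr0n; near: n; exact: nbhs_infty_gt.
have : \sum_(j < n) \1_(X j @^-1` [set true]) w < n%:R * (p + e k).
  by near: n; exact: upper.
have : \sum_(j < n) \1_(X j @^-1` [set false]) w < n%:R * (1 - p + e k).
  by near: n; exact: lower.
have -> : \sum_(j < n) \1_(X j @^-1` [set true]) w = (\sum_(j < n) X j w)%:R :> R.
  rewrite natr_sum; apply: eq_bigr => j _; rewrite indicE; congr (_%:R).
  by case: (boolP (X j w)) => Xj; [rewrite mem_set|rewrite memNset//= (negbTE Xj)].
have -> : \sum_(j < n) \1_(X j @^-1` [set false]) w =
    n%:R - (\sum_(j < n) X j w)%:R :> R.
  rewrite -[in n%:R](card_ord n) -sum1_card !natr_sum -sumrB.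
  apply: eq_bigr => j _; rewrite indicE.
  case: (boolP (X j w)) => Xj.
    by rewrite memNset ?subrr//= Xj.
  by rewrite mem_set ?subr0//=; apply/negbTE.
set S := (\sum_(j < n) _)%:R => lo up.
rewrite ler_norml; apply/andP; split.
  rewrite lerNl opprB lerBlDr ler_pdivrMr// (le_trans (ltW up))// mulrC.
  by rewrite ler_wpM2r ?ler0n// addrC lerD2r ltW.
rewrite lerBlDr -lerBlDl ler_pdivlMr//.
have : n%:R * e k <= n%:R * eps by rewrite ler_wpM2l// ltW.
by lra.
Unshelve. all: by end_near. Qed.

End frequency.

(** * Concentration of distributions at a point, and its passage through nodes *)

Section concentration.
Context (R : realType).
Implicit Types (mu : probability (measurableTypeR R) R).
Implicit Types (nu : nat -> probability (measurableTypeR R) R).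

(** Convergence in law to the point mass at [a], in terms of distribution functions. Nothing is
    asked at [x = a], where the limit jumps. *)
Definition concentrates nu (a : R) :=
  (forall x, x < a -> dist_fun (nu m) x @[m --> \oo] --> (0 : R)) /\
  (forall x, a < x -> dist_fun (nu m) x @[m --> \oo] --> (1 : R)).

(** The equations put all the mass in ]0, 1]; the last clause puts mass on both sides of every
    interior point, which excludes a zero variance. In this form the condition passes through the
    node formulas. *)
Definition full_unit_support mu :=
  [/\ dist_fun mu 0 = 0, dist_fun mu 1 = 1 &
      forall x, 0 < x < 1 -> 0 < dist_fun mu x < 1].

Lemma dist_funC mu x : fine (mu `]x, +oo[%classic) = 1 - dist_fun mu x.
Proof.
rewrite /dist_fun -setCitvl probability_setC//.
by rewrite fineB ?fin_num_measure.
Qed.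

Lemma dist_fun_fin mu x : (dist_fun mu x)%:E = mu `]-oo, x]%classic.
Proof. by rewrite /dist_fun fineK ?fin_num_measure. Qed.

Lemma dist_fun_node_posterior k n (mu_ : 'I_n.+1 -> probability (measurableTypeR R) R) x :
  dist_fun (node_posterior k mu_) x = node_cdf k mu_ x.
Proof.
have := cdf_lebesgue_stieltjes_id (node_cdf k mu_) x.
by rewrite /dist_fun /cdf /= => ->.
Qed.

(** A nonempty product of numbers of ]0, 1[ stays in ]0, 1[; for Min this is applied to the
    complements. *)
Lemma node_posterior_full_support k n (mu_ : 'I_n.+1 -> probability (measurableTypeR R) R) :
  (forall i, full_unit_support (mu_ i)) ->
  full_unit_support (node_posterior k mu_).
Proof.
move=> H; have d0 i : dist_fun (mu_ i) 0 = 0 by case: (H i).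
have d1 i : dist_fun (mu_ i) 1 = 1 by case: (H i).
have dx i x : 0 < x < 1 -> 0 < dist_fun (mu_ i) x < 1 by case: (H i) => _ _; apply.
have prod_lt1 (g : 'I_n.+1 -> R) : (forall i, 0 < g i < 1) ->
    0 < \prod_(i < n.+1) g i < 1.
  move=> g01; rewrite prodr_gt0/=; last by move=> i _; case/andP: (g01 i).
  rewrite big_ord_recl; case/andP: (g01 ord0) => g0 g1.
  apply: (le_lt_trans _ g1); rewrite ler_piMr ?(ltW g0)//.
  by apply: prodr_ile1 => i _; case/andP: (g01 (lift ord0 i)) => /ltW -> /ltW ->.
rewrite /full_unit_support !dist_fun_node_posterior; split.
- case: k => /=; first by rewrite big_ord_recl d0 mul0r.
  by under eq_bigr do rewrite d0 subr0; rewrite big1_eq subrr.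
- case: k => /=; first by under eq_bigr do rewrite d1; rewrite big1_eq.
  by rewrite big_ord_recl d1 subrr mul0r subr0.
- move=> x x01; rewrite dist_fun_node_posterior; case: k => /=.
    by apply: prod_lt1 => i; exact: dx.
  have /(prod_lt1 (fun i => 1 - dist_fun (mu_ i) x)) :
      forall i, 0 < 1 - dist_fun (mu_ i) x < 1.
    by move=> i; have := dx i x x01; lra.
  by lra.
Qed.

Lemma cvg_prod_1 n (g : 'I_n -> nat -> R) :
  (forall i, g i m @[m --> \oo] --> (1 : R)) ->
  \prod_(i < n) g i m @[m --> \oo] --> (1 : R).
Proof.
move=> g1; have : \prod_(i < n) g i m @[m --> \oo] --> \prod_(i < n) (1 : R).
  by apply: cvg_big => //; exact: mul_continuous.
by rewrite big1_eq.
Qed.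

Lemma cvg_prod_0 n (g : 'I_n -> nat -> R) i :
  (forall j m, 0 <= g j m <= 1) ->
  g i m @[m --> \oo] --> (0 : R) ->
  \prod_(i < n) g i m @[m --> \oo] --> (0 : R).
Proof.
move=> g01 gi; apply: squeeze_cvgr (cvg_cst 0) gi; apply: nearW => m.
rewrite prodr_ge0/=; last by move=> j _; case/andP: (g01 j m).
rewrite (bigD1 i)//= ler_piMr//; first by case/andP: (g01 i m).
by apply: prodr_ile1 => j _; exact: g01.
Qed.

(** For Max: below the maximum, a single child whose limit exceeds [x] sends the product to 0, the
    other factors being at most 1; above it, all factors tend to 1. For Min the same holds for the
    complements. *)
Lemma node_posterior_concentrates k n
    (nu_ : 'I_n.+1 -> nat -> probability (measurableTypeR R) R) (a_ : 'I_n.+1 -> R) :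
  (forall i, concentrates (nu_ i) (a_ i)) ->
  concentrates (fun m => node_posterior k (nu_ ^~ m))
    (match k with
     | Max => \big[Num.max/a_ ord0]_(i < n.+1) a_ i
     | Min => \big[Num.min/a_ ord0]_(i < n.+1) a_ i
     end).
Proof.
move=> H; have d0 i x : x < a_ i -> dist_fun (nu_ i m) x @[m --> \oo] --> (0 : R).
  by case: (H i) => + _; apply.
have d1 i x : a_ i < x -> dist_fun (nu_ i m) x @[m --> \oo] --> (1 : R).
  by case: (H i) => _; apply.
have c1 (g : nat -> R) (l : R) : g m @[m --> \oo] --> l -> 1 - g m @[m --> \oo] --> (1 - l : R).
  by move=> gl; apply: cvgB => //; exact: cvg_cst.
have c10 g : g m @[m --> \oo] --> (1 : R) -> 1 - g m @[m --> \oo] --> (0 : R).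
  by move=> /c1; rewrite subrr.
have c01 g : g m @[m --> \oo] --> (0 : R) -> 1 - g m @[m --> \oo] --> (1 : R).
  by move=> /c1; rewrite subr0.
have d01 i x m : 0 <= dist_fun (nu_ i m) x <= 1 by rewrite dist_fun_ge0 dist_fun_le1.
have Nd01 i x m : 0 <= 1 - dist_fun (nu_ i m) x <= 1.
  by have := d01 i x m; lra.
have eF k' x : (fun m => dist_fun (node_posterior k' (nu_ ^~ m)) x) =
    (fun m => node_cdf k' (nu_ ^~ m) x).
  by apply/funext => m; rewrite dist_fun_node_posterior.
case: k; split => x xa; rewrite eF/=.
- have [i xi] : exists i, x < a_ i.
    apply: contrapT => nx; move: xa; apply/negP; rewrite -leNgt.
    have ax i : a_ i <= x by rewrite leNgt; apply/negP => ?; apply: nx; exists i.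
    by apply: bigmax_le => // i _.
  by apply: (@cvg_prod_0 _ (fun i m => dist_fun (nu_ i m) x) i) => //; exact: d0.
- apply: (@cvg_prod_1 _ (fun i m => dist_fun (nu_ i m) x)) => i; apply: d1.
  by apply: le_lt_trans xa; exact: le_bigmax.
- apply: c10.
  apply: (@cvg_prod_1 _ (fun i m => 1 - dist_fun (nu_ i m) x)) => i.
  apply: c01; apply: d0.
  by apply: (lt_le_trans xa); exact: bigmin_le.
- have [i xi] : exists i, a_ i < x.
    apply: contrapT => nx; move: xa; apply/negP; rewrite -leNgt.
    have ax i : x <= a_ i by rewrite leNgt; apply/negP => ?; apply: nx; exists i.
    by apply: le_bigmin => // i _.
  apply: c01.
  apply: (@cvg_prod_0 _ (fun i m => 1 - dist_fun (nu_ i m) x) i) => //.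
  by apply: c10; exact: d1.
Qed.

(** * Convergence of integrals, means and standard deviations *)

Lemma mean_squareE mu :
  'V_mu[idfun] = (\int[mu]_x ((x - mean mu) ^+ 2)%:E)%E.
Proof. by rewrite /variance /mean unlock unlock. Qed.

(** On [D], the function is at most [e] plus [M] times the indicator of the two tails, whose masses
    are read off the distribution function. *)
Lemma integral_le_tails mu (g : R -> R) (D : set (measurableTypeR R)) (x y e M : R) :
  measurable_fun [set: measurableTypeR R] g -> (forall z, 0 <= g z) ->
  measurable D -> mu (~` D) = 0%E ->
  0 <= e -> 0 <= M ->
  (forall z, x < z <= y -> g z <= e) -> (forall z, D z -> g z <= M) ->
  (\int[mu]_z (g z)%:E <= (e + M * (dist_fun mu x + (1 - dist_fun mu y)))%:E)%E.
Proof.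
move=> mg g0 mD D0 e0 M0 ge gM.
have mA : measurable (`]-oo, x]%classic : set (measurableTypeR R)) by [].
have mB : measurable (`]y, +oo[%classic : set (measurableTypeR R)) by [].
have mI (A : set (measurableTypeR R)) : measurable A ->
    measurable_fun setT (fun z : measurableTypeR R => (\1_A z : R)%:E).
  by move=> ?; apply/measurable_EFinP; exact: measurable_indic.
pose b (z : measurableTypeR R) : \bar R :=
  (e%:E + M%:E * ((\1_(`]-oo, x]%classic) z)%:E + (\1_(`]y, +oo[%classic) z)%:E))%E.
have mb : measurable_fun setT b.
  apply: emeasurable_funD => //; apply: measurable_funeM.
  by apply: emeasurable_funD; exact: mI.
have b0 z : (0 <= b z)%E.
  by rewrite /b lee_fin; apply: addr_ge0 => //; apply: mulr_ge0 => //; exact: addr_ge0.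
apply: (@le_trans _ _ (\int[mu]_z b z)%E).
  have mgE : measurable_fun setT (fun z : measurableTypeR R => (g z)%:E) by exact/measurable_EFinP.
  rewrite (ge0_negligible_integral (measurableC mD))//; last first.
    by move=> z _; rewrite lee_fin.
  rewrite [leRHS](ge0_negligible_integral (measurableC mD))// setTD setCK.
  apply: ge0_le_integral => //.
  - by move=> z _; rewrite lee_fin.
  - exact: measurable_funTS.
  - exact: measurable_funTS.
  - move=> z Dz; rewrite /b lee_fin !indicE.
    have [zx|xz] := leP z x.
      rewrite mem_set ?in_itv//= mulrDr mulr1 addrCA ler_wpDr ?gM//.
      by rewrite addr_ge0// mulr_ge0.
    rewrite memNset ?in_itv/= ?add0r; last by apply/negP; rewrite -ltNge.
    have [zy|yz] := leP z y.
      by rewrite ler_wpDr ?mulr_ge0// ge ?xz.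
    rewrite mem_set/=; last by rewrite in_itv/= andbT.
    by rewrite mulr1 ler_wpDl ?gM.
rewrite /b ge0_integralD//; last 2 first.
- by move=> z _; rewrite lee_fin; apply: mulr_ge0 => //; exact: addr_ge0.
- by apply: measurable_funeM; apply: emeasurable_funD; exact: mI.
rewrite integral_cst// [X in (_ * X + _)%E](_ : _ = 1%E); last exact: probability_setT.
rewrite mule1 ge0_integralZl_EFin//; last 2 first.
- by move=> z _; rewrite lee_fin; exact: addr_ge0.
- by apply: emeasurable_funD; exact: mI.
rewrite ge0_integralD//; [|exact: mI|exact: mI].
rewrite !integral_indic// !setIT EFinD EFinM EFinD dist_fun_fin -dist_funC.
by rewrite fineK ?fin_num_measure.
Qed.

Lemma unit_support_negligible mu : full_unit_support mu ->
  mu (~` `]0, 1]%classic) = 0%E.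
Proof.
move=> [mu0 mu1 _].
have -> : ~` `]0, 1]%classic = `]-oo, 0]%classic `|` `]1, +oo[%classic :> set R.
  apply/seteqP; split => x /=; rewrite !in_itv/= andbT.
    by move=> /negP; rewrite negb_and -leNgt -ltNge => /orP.
  by move=> [x0|x1]; apply/negP; rewrite negb_and -leNgt -ltNge ?x0 ?x1 ?orbT.
rewrite measureU0//.
  exact: etrans (esym (dist_fun_fin mu 0)) (congr1 EFin mu0).
by rewrite -[LHS]fineK ?fin_num_measure// dist_funC mu1 subrr.
Qed.

Lemma full_support_le_tails mu (g : R -> R) (x y e : R) :
  full_unit_support mu ->
  measurable_fun [set: measurableTypeR R] g -> (forall z, 0 <= g z) -> 0 <= e ->
  (forall z, x < z <= y -> g z <= e) -> (forall z, 0 < z <= 1 -> g z <= 1) ->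
  (\int[mu]_z (g z)%:E <= (e + (dist_fun mu x + (1 - dist_fun mu y)))%:E)%E.
Proof.
move=> mu01 mg g0 e0 ge g1.
have := @integral_le_tails mu g `]0, 1]%classic x y e 1 mg g0 _
  (unit_support_negligible mu01) e0 ler01 ge.
by rewrite mul1r; apply.
Qed.

(* The identity is not bounded; [clip] is, and has the same mean under a
   distribution supported by ]0, 1]. *)
Definition clip (x : R) : R := Num.min (Num.max x 0) 1.

Lemma clip01 x : 0 <= clip x <= 1.
Proof. by rewrite /clip le_min le_max lexx orbT ler01 ge_min lexx orbT. Qed.

Lemma measurable_clip : measurable_fun [set: measurableTypeR R] clip.
Proof. by apply: measurable_minr => //; exact: measurable_maxr. Qed.

Lemma integrable_clip mu : mu.-integrable setT (EFin \o clip).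
Proof.
apply: measurable_bounded_integrable => //.
- by rewrite ltey_eq fin_num_measure.
- exact: measurable_clip.
- exists 1; split => // M M1 x _ /=; have /andP[c0 c1] := clip01 x.
  by rewrite ger0_norm// (le_trans c1)// ltW.
Qed.

Lemma meanE mu : full_unit_support mu -> mean mu = \int[mu]_x clip x.
Proof.
move=> mu01; rewrite /mean unlock /Rintegral; congr fine.
apply: ae_eq_integral => //.
- by apply/measurable_EFinP; exact: measurable_id.
- by apply/measurable_EFinP; exact: measurable_clip.
exists (~` `]0, 1]%classic); split.
- exact: measurableC.
- exact: unit_support_negligible.
- move=> x /= nx x01; apply: nx => _; congr EFin; move: x01.
  rewrite in_itv/= => /andP[x0 x1].
  by rewrite /clip max_l ?min_l// ltW.
Qed.

Lemma mean01 mu : full_unit_support mu -> 0 <= mean mu <= 1.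
Proof.
move=> mu01; rewrite meanE//; apply/andP; split.
  by apply: Rintegral_ge0 => x _; case/andP: (clip01 x).
have -> : (1 : R) = \int[mu]_x cst 1 x.
  by rewrite Rintegral_cst// mul1r [X in fine X](_ : _ = 1%E)//; exact: probability_setT.
apply: le_Rintegral => //; first exact: integrable_clip.
  exact: finite_measure_integrable_cst.
by move=> x _; case/andP: (clip01 x).
Qed.

Lemma stddev_gt0 mu : full_unit_support mu -> 0 < stddev mu.
Proof.
move=> mu01; rewrite /stddev sqrtr_gt0 mean_squareE.
have /andP[m0 m1] := mean01 mu01; set m := mean mu in m0 m1 *.
have mg : measurable_fun [set: measurableTypeR R] (fun x : R => (x - m) ^+ 2).
  by apply: measurable_funX; exact: measurable_funB.
(* [fine] sends an infinite value to 0, so the variance must also be shown finite. *)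
rewrite fine_gt0//; apply/andP; split; last first.
  apply: le_lt_trans (ltry _); apply: (@full_support_le_tails mu _ 0 1 1) => //.
  - by move=> z; exact: sqr_ge0.
  - by move=> z /andP[z0 z1]; nra.
  - by move=> z /andP[z0 z1]; nra.
(* Any set of positive mass at distance at least 1/6 from the mean makes the variance positive;
   [36^-1] is the square of 1/6. *)
have lower (A : set (measurableTypeR R)) : measurable A -> (0 < mu A)%E ->
    (forall x, A x -> 36^-1 <= (x - m) ^+ 2) -> (0 < \int[mu]_x ((x - m) ^+ 2)%:E)%E.
  move=> mA A0 Am; apply: (@lt_le_trans _ _ (36^-1%:E * mu A)%E).
    by rewrite mule_gt0// lte_fin invr_gt0.
  rewrite -integral_cst//.
  apply: (@le_trans _ _ (\int[mu]_(x in A) ((x - m) ^+ 2)%:E)%E).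
    apply: ge0_le_integral => //.
    - by move=> x _; rewrite lee_fin invr_ge0.
    - by apply/measurable_EFinP; exact: measurable_funTS.
  apply: ge0_subset_integral => //; first exact/measurable_EFinP.
  by move=> x _; rewrite lee_fin sqr_ge0.
have [_ _ mux] := mu01.
(* The mean is at distance at least 1/6 from ]-oo, 1/3] or from ]2/3, +oo[. *)
have [m12|m12] := leP 2^-1 m.
- apply: (lower `]-oo, 3^-1]%classic) => //.
    rewrite -dist_fun_fin lte_fin.
    by have /mux/andP[] : 0 < (3^-1 : R) < 1 by lra.
  by move=> x /=; rewrite in_itv/= => x3; nra.
- apply: (lower `]2/3, +oo[%classic) => //.
    rewrite -[ltRHS]fineK ?fin_num_measure// dist_funC lte_fin subr_gt0.
    by have /mux/andP[] : 0 < (2 / 3 : R) < 1 by lra.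
  by move=> x /=; rewrite in_itv/= andbT => x3; nra.
Qed.

Lemma concentrates_tails nu a r : concentrates nu a -> 0 < r ->
  dist_fun (nu m) (a - r) + (1 - dist_fun (nu m) (a + r)) @[m --> \oo] --> (0 : R).
Proof.
move=> [lower upper] r0; rewrite [X in _ --> X](_ : 0 = 0 + (1 - 1) :> R); last first.
  by rewrite subrr addr0.
apply: cvgD; first by apply: lower; rewrite gtrBl.
by apply: cvgB; [exact: cvg_cst|apply: upper; rewrite ltrDl].
Qed.

(** The window is half-open to match the hypothesis of [integral_le_tails]. *)
Lemma cvg_near_ball (h : R -> R) (a e : R) : {for a, continuous h} -> 0 < e ->
  exists2 r : R, 0 < r & forall x : R, a - r < x <= a + r -> `|h x - h a| <= e.
Proof.
move=> /cvgrPdist_le/(_ e) + e0 => /(_ e0)/nbhs_ballP[r /= r0 br].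
exists (r / 2) => [|x xr]; first exact: divr_gt0.
rewrite distrC; apply: br; rewrite /ball/= ltr_distl; apply/andP; split; lra.
Qed.

(** Near [a] the function varies by at most half the tolerance; elsewhere it varies by at most
    [M + M], on tails whose mass tends to 0. *)
Lemma concentrates_Rintegral nu (a : R) (h : R -> R) (M : R) :
  concentrates nu a -> {for a, continuous h} ->
  measurable_fun [set: measurableTypeR R] h -> (forall x, `|h x| <= M) ->
  \int[nu m]_x h x @[m --> \oo] --> h a.
Proof.
move=> nua ch mh hM; apply/cvgrPdist_le => /= e e0.
have [r r0 hr] := cvg_near_ball ch (divr_gt0 e0 (ltr0n _ 2)).
have M0 : 0 <= M by apply: le_trans (hM 0).
have ih m : (nu m).-integrable setT (EFin \o h).
  apply: measurable_bounded_integrable => //.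
    by rewrite ltey_eq fin_num_measure.
  by exists M; split; [exact: num_real|move=> N MN x _; exact: le_trans (hM x) (ltW MN)].
near=> m.
have nu1 : fine (nu m [set: measurableTypeR R]) = 1.
  by rewrite [X in fine X](_ : _ = 1%E)//; exact: probability_setT.
have <- : \int[nu m]_x h a = h a by rewrite Rintegral_cst// nu1 mulr1.
rewrite distrC -RintegralB//; [|exact: ih|exact: finite_measure_integrable_cst].
have ihB : (nu m).-integrable setT (EFin \o (fun x => h x - h a)).
  rewrite (_ : _ \o _ = ((EFin \o h) \- (EFin \o cst (h a)))%E)//.
  apply: integrableB => //; first exact: ih.
  exact: finite_measure_integrable_cst.
apply: (le_trans (le_normr_Rintegral _ ihB)) => //.
rewrite -lee_fin /Rintegral fineK; last first.
  by apply: integrable_fin_num => //; exact: (integrable_abse ihB).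
have D0 : nu m (~` [set: measurableTypeR R]) = 0%E by rewrite setCT measure0.
apply: (le_trans (@integral_le_tails (nu m) (fun x => `|h x - h a|) setT
    (a - r) (a + r) (e / 2) (M + M) _ _ _ D0 _ _ hr _)) => //.
- by apply: measurableT_comp => //; exact: measurable_funB.
- by rewrite divr_ge0// ltW.
- by rewrite addr_ge0.
- by move=> z _; rewrite (le_trans (ler_normB _ _))// lerD.
rewrite lee_fin [leRHS]splitr lerD2l.
near: m; have := concentrates_tails nua r0.
move=> /(cvgM (cvg_cst (M + M : R))); rewrite mulr0 => /cvgrPdist_le/(_ (e / 2)); rewrite divr_gt0// => /(_ isT).
by apply: filterS => m /=; rewrite sub0r normrN; apply: le_trans; exact: ler_norm.
Unshelve. all: by end_near. Qed.

Lemma concentrates_weak_cvg nu a : concentrates nu a ->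
  weak_cvg nu (dirac (a : measurableTypeR R)).
Proof.
move=> nua h ch [M hM].
have mh : measurable_fun [set: measurableTypeR R] h by exact: continuous_measurable_fun.
rewrite integral_dirac//; last exact/measurable_EFinP.
rewrite diracT mul1e; apply: cvg_EFin; last first.
  exact: (concentrates_Rintegral nua (ch a) mh hM).
apply: nearW => m; apply: integrable_fin_num => //.
apply: measurable_bounded_integrable => //.
  by rewrite ltey_eq fin_num_measure.
by exists M; split; [exact: num_real|move=> N MN x _; exact: le_trans (hM x) (ltW MN)].
Qed.

Lemma mean_cvg nu a : 0 <= a <= 1 -> (forall m, full_unit_support (nu m)) ->
  concentrates nu a -> mean (nu m) @[m --> \oo] --> a.
Proof.
move=> /andP[a0 a1] nu01 nua.
have -> : (fun m => mean (nu m)) = (fun m => \int[nu m]_x clip x).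
  by apply/funext => m; rewrite meanE.
have clipa : clip a = a by rewrite /clip max_l// min_l.
rewrite -[X in _ --> X]clipa; apply: (@concentrates_Rintegral _ _ _ 1) => //.
- apply: continuous_min; last exact: cvg_cst.
  by apply: continuous_max; [exact: cvg_id|exact: cvg_cst].
- exact: measurable_clip.
- by move=> x; have /andP[c0 c1] := clip01 x; rewrite ger0_norm.
Qed.

Lemma stddev_cvg0 nu a : 0 <= a <= 1 -> (forall m, full_unit_support (nu m)) ->
  concentrates nu a -> stddev (nu m) @[m --> \oo] --> (0 : R).
Proof.
move=> a01 nu01 nua; rewrite /stddev -(@sqrtr0 R).
apply: continuous_cvg; first exact: sqrt_continuous.
apply/cvgrPdist_le => /= e e0.
(* The mean ends up within [r] of [a], so the window lies within [2 r] of the mean, where the square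
   is at most [4 r ^+ 2 <= 4 r <= e / 2]. The tails contribute the other [e / 2]. *)
pose r := Num.min (e / 8) 1.
have r0 : 0 < r by rewrite lt_min ltr01 divr_gt0.
have re : r <= e / 8 by rewrite ge_min lexx.
have r1 : r <= 1 by rewrite ge_min lexx orbT.
near=> m.
have ma : `|a - mean (nu m)| <= r.
  by near: m; have /cvgrPdist_le := mean_cvg a01 nu01 nua; exact.
have tails : dist_fun (nu m) (a - r) + (1 - dist_fun (nu m) (a + r)) <= e / 2.
  near: m; have /cvgrPdist_le/(_ (e / 2)) := concentrates_tails nua r0.
  rewrite divr_gt0// => /(_ isT).
  by apply: filterS => m /=; rewrite sub0r normrN; apply: le_trans; exact: ler_norm.
rewrite sub0r normrN ger0_norm; last by rewrite fine_ge0// variance_ge0.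
rewrite mean_squareE; have /andP[m0 m1] := mean01 (nu01 m).
set c := mean (nu m) in ma m0 m1 *; move: ma; rewrite ler_distl => /andP[am ma].
have le_int : (\int[nu m]_x ((x - c) ^+ 2)%:E <= e%:E)%E.
  apply: (le_trans (@full_support_le_tails (nu m) (fun x => (x - c) ^+ 2)
    (a - r) (a + r) (4 * r) (nu01 m) _ _ _ _ _)).
  - by apply: measurable_funX; exact: measurable_funB.
  - by move=> z; exact: sqr_ge0.
  - by rewrite mulr_ge0// ltW.
  - by move=> z /andP[z1 z2]; nra.
  - by move=> z /andP[z0 z1]; nra.
  - by rewrite lee_fin; lra.
rewrite -lee_fin fineK// ge0_fin_numE.
  exact: le_lt_trans le_int (ltry _).
by apply: integral_ge0 => z _; rewrite lee_fin sqr_ge0.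
Unshelve. all: by end_near. Qed.

End concentration.

(** * Posterior masses at a leaf *)

Section leaf_posterior_theory.
Context (R : realType) (f : prior R).
Hypothesis f_gt0 : forall p : R, 0 < p < 1 -> 0 < f p.
Implicit Types (W L : nat) (A B : set (measurableTypeR R)) (p q K : R).

Local Notation lambda := (@lebesgue_measure R).
Local Notation U W L := (unnormalized_posterior f W L).

Let in01 p : (`]0, 1[%classic : set R) p -> 0 < p < 1.
Proof. by rewrite /= in_itv. Qed.

Lemma likelihood_gt0 W L p : 0 < p < 1 -> 0 < p ^+ W * (1 - p) ^+ L.
Proof. by move=> /andP[p0 p1]; rewrite mulr_gt0// exprn_gt0// subr_gt0. Qed.

(* [x <= exp (x - 1)] at [x = p / q] and at [x = (1 - p) / (1 - q)]. *)
Lemma likelihood_le W L p q : 0 < p < 1 -> 0 < q < 1 ->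
  p ^+ W * (1 - p) ^+ L <=
  expR ((q - p) * ((W + L)%:R * q - W%:R) / (q * (1 - q))) *
  (q ^+ W * (1 - q) ^+ L).
Proof.
move=> p01 q01; have [q0 q1] : 0 < q /\ 0 < 1 - q by lra.
have ratio (x y : R) n : 0 < x -> 0 < y ->
    x ^+ n <= expR (n%:R * (x / y - 1)) * y ^+ n.
  move=> x0 y0; rewrite -ler_pdivrMr ?exprn_gt0// -expr_div_n expRM_natl.
  apply: lerXn2r; rewrite ?nnegrE ?expR_ge0 ?divr_ge0 ?(ltW x0) ?(ltW y0)//.
  by apply: (le_trans _ (expR_ge1Dx _)); lra.
apply: (@le_trans _ _ ((expR (W%:R * (p / q - 1)) * q ^+ W) *
    (expR (L%:R * ((1 - p) / (1 - q) - 1)) * (1 - q) ^+ L))).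
  apply: ler_pM; rewrite ?exprn_ge0//; [lra|lra| |].
  - by apply: ratio; lra.
  - by apply: ratio; lra.
rewrite mulrACA -expRD le_eqVlt; apply/orP; left; apply/eqP.
congr (expR _ * _); rewrite natrD; field.
by rewrite !gt_eqF.
Qed.

Lemma measurable_unnormalized W L A :
  measurable_fun (A `&` `]0, 1[) (fun p => (p ^+ W * (1 - p) ^+ L * f p)%:E).
Proof.
have mw : measurable_fun (`]0, 1[%classic : set R)
    (fun p : R => p ^+ W * (1 - p) ^+ L * f p).
  apply: measurable_funM; last exact: density_measurable.
  apply: measurable_funM; apply: measurable_funX => //.
  exact: measurable_funB.
by apply/measurable_EFinP; apply: measurable_funS mw => //; exact: subIsetr.
Qed.

Lemma unnormalized_le1 W L A : measurable A -> (U W L A <= 1)%E.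
Proof.
move=> mA; rewrite -(density_integral f).
apply: (@le_trans _ _ (U W L setT)).
  by apply: le_measure; rewrite ?inE.
rewrite /unnormalized_posterior setTI; apply: ge0_le_integral => //.
- move=> p /in01 p01; rewrite lee_fin mulr_ge0//; last exact/ltW/f_gt0.
  exact/ltW/likelihood_gt0.
- by have := @measurable_unnormalized W L setT; rewrite setTI.
- by apply/measurable_EFinP; exact: density_measurable.
- move=> p /in01 p01; rewrite lee_fin ler_piMl//; first exact/ltW/f_gt0.
  by rewrite mulr_ile1 ?exprn_ge0 ?exprn_ile1//; lra.
Qed.

Lemma unnormalized_fin W L A : measurable A -> U W L A \is a fin_num.
Proof.
move=> mA; rewrite ge0_fin_numE//.
exact: (le_lt_trans (unnormalized_le1 W L mA) (ltry _)).
Qed.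

(** The integrand is positive on ]0, 1[, so a zero integral would force the domain to be a null
    set. *)
Lemma unnormalized_gt0 W L A : measurable A ->
  (0 < lambda (A `&` `]0%R, 1%R[))%E -> (0 < U W L A)%E.
Proof.
move=> mA A0; rewrite lt0e measure_ge0 andbT; apply/eqP => U0.
have mD : measurable (A `&` `]0%R, 1%R[) by exact: measurableI.
move: A0; apply/negP; rewrite -leNgt.
have /(ae_eq_integral_abs lambda mD (@measurable_unnormalized W L A))[N [mN N0 DN]] :
    (\int[lambda]_(p in A `&` `]0%R, 1%R[)
       `|(p ^+ W * (1 - p) ^+ L * f p)%:E| = 0)%E.
  rewrite -U0; apply: eq_integral => p /set_mem[_ /in01 p01].
  by rewrite gee0_abs// lee_fin ltW// mulr_gt0 ?likelihood_gt0 ?f_gt0.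
rewrite -N0; apply: le_measure; rewrite ?inE// => p Dp; apply: DN => /= /(_ Dp).
have [_ /in01 p01] := Dp.
by move=> [] /eqP; rewrite gt_eqF// mulr_gt0 ?likelihood_gt0 ?f_gt0.
Qed.

Lemma unnormalized_itv_gt0 W L (x y : R) A : measurable A ->
  0 <= x -> x < y -> y <= 1 -> `]x, y[ `<=` A -> (0 < U W L A)%E.
Proof.
move=> mA x0 xy y1 xyA; apply: unnormalized_gt0 => //.
apply: (@lt_le_trans _ _ (lambda `]x, y[%classic)).
  by rewrite lebesgue_measure_itv/= lte_fin xy -EFinB lte_fin subr_gt0.
apply: le_measure; rewrite ?inE//; first exact: measurableI.
move=> z zxy; split; first exact: xyA.
by move: zxy; rewrite /= !in_itv/= => /andP[xz zy]; lra.
Qed.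

(** The total mass is positive and at most 1, so [mnormalize] divides by it instead of taking its
    default value. *)
Lemma leaf_posteriorE W L A : measurable A ->
  leaf_posterior f W L A = (U W L A * (fine (U W L setT))^-1%:E)%E.
Proof.
move=> mA; have mnormE (mu : {measure set (measurableTypeR R) -> \bar R}) P :
    (0 < mu setT)%E -> (mu setT <= 1)%E ->
    mnormalize mu P A = (mu A * (fine (mu setT))^-1%:E)%E.
  move=> mu0 mu1; rewrite /mnormalize ifF//; apply/negbTE; rewrite negb_or.
  by rewrite gt_eqF//= -ltey (le_lt_trans mu1)// ltry.
apply: mnormE; last exact: unnormalized_le1.
by apply: (@unnormalized_itv_gt0 _ _ 0 1).
Qed.

(* Integrating the comparison over [q] in [B] against the prior turns a
   pointwise likelihood ratio into a ratio of posterior masses. *)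
Lemma leaf_posterior_le W L A B K : measurable A -> measurable B -> 0 <= K ->
  (forall p q, 0 < p < 1 -> 0 < q < 1 -> A p -> B q ->
    p ^+ W * (1 - p) ^+ L <= K * (q ^+ W * (1 - q) ^+ L)) ->
  (0 < U 0 0 B)%E ->
  fine (leaf_posterior f W L A) <= K / fine (U 0 0 B).
Proof.
move=> mA mB K0 AB UB0.
have f0 p : 0 < p < 1 -> 0 <= f p by move=> p01; exact/ltW/f_gt0.
have l0 p : 0 < p < 1 -> 0 <= p ^+ W * (1 - p) ^+ L.
  by move=> p01; exact/ltW/likelihood_gt0.
have mAI : measurable (A `&` `]0%R, 1%R[) by exact: measurableI.
have mBI : measurable (B `&` `]0%R, 1%R[) by exact: measurableI.
have mf (C : set (measurableTypeR R)) :
    measurable_fun (C `&` `]0, 1[) (fun p => (f p)%:E).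
  rewrite (_ : (fun _ => _) = fun p => (p ^+ 0 * (1 - p) ^+ 0 * f p)%:E).
    exact: measurable_unnormalized.
  by apply/funext => p; rewrite !expr0 !mul1r.
(* Without observations the likelihood is 1, so [U 0 0] is the prior measure. *)
have U00 (C : set (measurableTypeR R)) : U 0 0 C = (\int[lambda]_(p in C `&` `]0%R, 1%R[) (f p)%:E)%E.
  by apply: eq_integral => p _; rewrite !expr0 !mul1r.
(* First integrate over [p] in [A] with [q] fixed; the prior mass of [A] is at most 1. *)
have UA q : 0 < q < 1 -> B q -> (U W L A <= (K * (q ^+ W * (1 - q) ^+ L))%:E)%E.
  move=> q01 Bq; set g := K * _.
  have g0 : 0 <= g by rewrite mulr_ge0 ?l0.
  apply: (@le_trans _ _ (g%:E * U 0 0 A)%E); last first.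
    by rewrite -[leRHS]mule1 lee_wpmul2l ?lee_fin ?unnormalized_le1.
  rewrite U00 -ge0_integralZl_EFin//; last by move=> p [_ /in01 /f0]; rewrite lee_fin.
  apply: ge0_le_integral => //.
  - by move=> p [_ /in01 p01]; rewrite lee_fin mulr_ge0 ?l0 ?f0.
  - exact: measurable_unnormalized.
  - exact: measurable_funeM.
  - move=> p [Ap /in01 p01]; rewrite -EFinM lee_fin ler_wpM2r ?f0//.
    exact: AB.
(* Then integrate over [q] in [B]; the left side is constant in [q] and picks up the prior mass of
   [B]. *)
have UAB : (U W L A * U 0 0 B <= K%:E * U W L B)%E.
  have a0 : 0 <= fine (U W L A) by rewrite fine_ge0.
  have aE : (fine (U W L A))%:E = U W L A by rewrite fineK ?unnormalized_fin.
  rewrite -aE U00; move: (fine _) a0 aE => a a0 aE.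
  rewrite -ge0_integralZl_EFin//; last first.
    by move=> p [_ /in01 /f0]; rewrite lee_fin.
  rewrite /unnormalized_posterior -ge0_integralZl_EFin//; last first.
  - exact: measurable_unnormalized.
  - by move=> p [_ /in01 p01]; rewrite lee_fin mulr_ge0 ?l0 ?f0.
  apply: ge0_le_integral => //.
  - by move=> p [_ /in01 p01]; rewrite -EFinM lee_fin mulr_ge0 ?f0.
  - exact: measurable_funeM.
  - by apply: measurable_funeM; exact: measurable_unnormalized.
  - move=> q [Bq /in01 q01]; rewrite -!EFinM lee_fin mulrA ler_wpM2r ?f0//.
    by rewrite -lee_fin aE UA.
have UT0 : 0 < fine (U W L setT).
  apply: fine_gt0; rewrite (@unnormalized_itv_gt0 _ _ 0 1)//=.
  exact: (le_lt_trans (unnormalized_le1 W L measurableT) (ltry _)).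
have UB0' : 0 < fine (U 0 0 B).
  apply: fine_gt0; rewrite UB0/=.
  exact: (le_lt_trans (unnormalized_le1 0 0 mB) (ltry _)).
rewrite leaf_posteriorE// fineM ?unnormalized_fin//= ler_pdivrMr// mulrAC.
rewrite ler_pdivlMr//.
rewrite -fineM ?unnormalized_fin//.
apply: (@le_trans _ _ (K * fine (U W L B))).
  rewrite -lee_fin EFinM !fineK ?unnormalized_fin//.
  by rewrite fin_numM ?unnormalized_fin.
rewrite ler_wpM2l// fine_le ?unnormalized_fin//.
by apply: le_measure; rewrite ?inE.
Qed.


(** No finite number of observations removes the mass of a subinterval of ]0, 1[, as prior and
    likelihood are positive there. *)
Lemma leaf_posterior_full_support W L : full_unit_support (leaf_posterior f W L).
Proof.
have UT0 : 0 < fine (U W L setT).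
  apply: fine_gt0; rewrite (@unnormalized_itv_gt0 _ _ 0 1)//=.
  exact: (le_lt_trans (unnormalized_le1 W L measurableT) (ltry _)).
have post_gt0 x y A : measurable A -> 0 <= x -> x < y -> y <= 1 ->
    `]x, y[ `<=` A -> 0 < fine (leaf_posterior f W L A).
  move=> mA x0 xy y1 xyA; rewrite leaf_posteriorE// fineM ?unnormalized_fin//=.
  rewrite mulr_gt0 ?invr_gt0// fine_gt0// (unnormalized_itv_gt0 W L mA x0 xy)//=.
  exact: (le_lt_trans (unnormalized_le1 W L mA) (ltry _)).
have post0 A : measurable A -> A `&` `]0, 1[ = set0 ->
    fine (leaf_posterior f W L A) = 0.
  move=> mA A0; rewrite leaf_posteriorE// /unnormalized_posterior A0.
  by rewrite integral_set0 mul0e.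
split.
- apply: post0 => //; apply/seteqP; split => // x [] /=.
  by rewrite !in_itv/= => x0 /andP[]; rewrite ltNge x0.
- apply/eqP; rewrite -subr_eq0 -oppr_eq0 opprB -dist_funC; apply/eqP.
  apply: post0 => //; apply/seteqP; split => // x [] /=.
  by rewrite !in_itv/= andbT => x1 /andP[_]; rewrite ltNge (ltW x1).
- move=> x /andP[x0 x1]; rewrite -[_ < 1]subr_gt0 -dist_funC.
  apply/andP; split.
    apply: (post_gt0 0 x) => //; first exact: ltW.
    by move=> y /=; rewrite !in_itv/= => /andP[_ /ltW].
  apply: (post_gt0 x 1) => //; first exact: ltW.
  by move=> y /=; rewrite !in_itv/= => /andP[->].
Qed.

(** * Consistency of the leaf posterior *)

Section consistency.
Variables (W L : nat -> nat) (a : R).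
Hypothesis a01 : 0 < a < 1.
Hypothesis WL_oo : (W m + L m)%N @[m --> \oo] --> \oo.
Hypothesis W_freq : (W m)%:R / (W m + L m)%:R @[m --> \oo] --> a.

(** Every point of [A] is compared with a fixed window ]y, z[ of positive prior mass. The likelihood
    ratio is at most [exp (- k n)] after [n] observations, so the posterior mass of [A] vanishes. *)
Lemma leaf_posterior_cvg0 A y z k : measurable A ->
  0 <= y -> y < z -> z <= 1 -> 0 < k ->
  (\forall m \near \oo, forall p q, 0 < p < 1 -> A p -> y < q < z ->
     (q - p) * ((W m + L m)%:R * q - (W m)%:R) <= - (k * (W m + L m)%:R)) ->
  fine (leaf_posterior f (W m) (L m) A) @[m --> \oo] --> 0.
Proof.
move=> mA y0 yz z1 k0 near_le.
have B0 : (0 < U 0 0 `]y, z[%classic)%E by apply: (unnormalized_itv_gt0 _ _ _ y0 yz).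
have e0 : expR (- (k * (W m + L m)%:R)) / fine (U 0 0 `]y, z[%classic)
    @[m --> \oo] --> 0.
  rewrite -(mul0r (fine (U 0 0 `]y, z[%classic))^-1); apply: cvgMl.
  have kn : k * (W m + L m)%:R @[m --> \oo] --> +oo.
    apply/cvgryPge => M; near do rewrite mulrC -ler_pdivrMr//.
    by apply: (proj1 (cvgryPge _)); exact/cvgrnyP.
  exact: (cvg_comp _ _ kn (@cvgr_expR R)).
apply: squeeze_cvgr (cvg_cst 0) e0.
near=> m; apply/andP; split; first by rewrite fine_ge0.
apply: leaf_posterior_le => //.
move=> p q p01 q01 Ap Bq; apply: le_trans (likelihood_le _ _ p01 q01) _.
rewrite ler_wpM2r//; first exact/ltW/likelihood_gt0.
rewrite ler_expR.
set c := (q - p) * _.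
have : c <= - (k * (W m + L m)%:R).
  by move: Bq; rewrite /c/= in_itv/= => Bq; move: p q p01 Ap Bq {q01 c}; near: m.
have [q0 q1] : 0 < q /\ q < 1 by lra.
have qq : 0 < q * (1 - q) by rewrite mulr_gt0// subr_gt0.
have kn : 0 <= k * (W m + L m)%:R by rewrite mulr_ge0// ltW.
(* As [q (1 - q) <= 1], dividing a negative number by it only lowers the exponent. *)
move=> cl; rewrite ler_pdivrMr//; apply: (le_trans cl).
rewrite mulNr lerN2 ler_piMr//; nra.
Unshelve. all: by end_near. Qed.

Lemma leaf_posterior_concentrates :
  concentrates (fun m => leaf_posterior f (W m) (L m)) a.
Proof.
have /andP[a0 a1] := a01.
have n0 : \forall m \near \oo, (0 < (W m + L m)%:R :> R).
  near=> m; rewrite ltr0n; near: m; exact: (WL_oo (nbhs_infty_gt 0)).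
split => x xa.
(* Cutting [x] off at 0 keeps the comparison window inside the unit interval. *)
- have [x' [x'0 xx' x'a]] : exists x', [/\ 0 <= x', x <= x' & x' < a].
    by exists (Num.max x 0); rewrite !le_max !lexx orbT gt_max xa.
  (* The gap is cut in four: [p <= x'], [q] lies between [x' + e] and [x' + 2 e], and the frequency
     eventually exceeds [x' + 3 e]. Hence [q - p > e] and [n q - w < - n e], which gives the rate
     [e * e]. *)
  have [e e0 ae] : exists2 e, 0 < e & a = x' + 4 * e.
    by exists ((a - x') / 4); lra.
  apply: (@leaf_posterior_cvg0 _ (x' + e) (x' + 2 * e) (e * e)) => //.
  + by lra.
  + by lra.
  + by lra.
  + by rewrite mulr_gt0.
  near=> m => p q p01 /=; rewrite in_itv/= => px yqz.
  have nm : 0 < (W m + L m)%:R :> R by near: m.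
  have : x' + 3 * e < (W m)%:R / (W m + L m)%:R.
    near: m; apply: (cvgr_gt a) => //; lra.
  rewrite ltr_pdivlMr//; move: ((W m + L m)%:R) nm => n nm.
  move: ((W m)%:R) => w wn.
  rewrite -lerN2 opprK -mulrN opprB -mulrA.
  apply: ler_pM; rewrite ?mulr_ge0 ?ltW//; nra.
(* Mirror image for the upper tail, with [x] cut off at 1. *)
- suff : fine (leaf_posterior f (W m) (L m) `]x, +oo[%classic) @[m --> \oo] --> 0.
    under eq_fun do rewrite dist_funC.
    move=> h.
    have : 1 - (1 - dist_fun (leaf_posterior f (W m) (L m)) x) @[m --> \oo] --> (1 - 0 : R).
      by apply: cvgB h; exact: cvg_cst.
    by rewrite subr0; under eq_fun do rewrite subKr.
  have [x' [x'0 xx' x'a]] : exists x', [/\ x' <= 1, x' <= x & a < x'].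
    by exists (Num.min x 1); rewrite !ge_min !lexx orbT lt_min xa.
  have [e e0 ae] : exists2 e, 0 < e & a = x' - 4 * e.
    by exists ((x' - a) / 4); lra.
  apply: (@leaf_posterior_cvg0 _ (x' - 2 * e) (x' - e) (e * e)) => //.
  + by lra.
  + by lra.
  + by lra.
  + by rewrite mulr_gt0.
  near=> m => p q p01 /=; rewrite in_itv/= andbT => px yqz.
  have nm : 0 < (W m + L m)%:R :> R by near: m.
  have : (W m)%:R / (W m + L m)%:R < x' - 3 * e.
    near: m; apply: (cvgr_lt a) => //; lra.
  rewrite ltr_pdivrMr//; move: ((W m + L m)%:R) nm => n nm.
  move: ((W m)%:R) => w wn.
  rewrite -lerN2 opprK -mulNr opprB -mulrA.
  apply: ler_pM; rewrite ?mulr_ge0 ?ltW//; nra.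
Unshelve. all: by end_near. Qed.

End consistency.

End leaf_posterior_theory.

(** * Runs of the policy on a fixed sequence of payoffs *)

Section observations.
Context (R : realType).
Implicit Types (t : tree R).

Definition regular t := forall l : leaf t,
  0 < win_rate l < 1 /\ forall p : R, 0 < p < 1 -> 0 < leaf_prior l p.

(** This is the almost sure event; on it the rest of the argument is deterministic. *)
Definition typical t (x : leaf t -> nat -> bool) := forall l : leaf t,
  (\sum_(j < n) x l j)%:R / n%:R @[n --> \oo] --> win_rate l.

Definition child_leaf k n (c : 'I_n.+1 -> tree R) (i : 'I_n.+1)
    (l : leaf (c i)) : leaf (Node k n c) :=
  Tagged (fun i => leaf (c i)) l.
Arguments child_leaf k {n c} i l.

Lemma regular_child k n (c : 'I_n.+1 -> tree R) i :
  regular (Node k n c) -> regular (c i).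
Proof. by move=> reg l; exact: (reg (child_leaf k i l)). Qed.

Lemma typical_child k n (c : 'I_n.+1 -> tree R) i x :
  @typical (Node k n c) x -> typical (x \o child_leaf k i).
Proof. by move=> typ l; exact: (typ (child_leaf k i l)). Qed.

(** [observed] with the visit counts as an argument: restriction to a subtree becomes composition
    with [child_leaf]. *)
Definition after_visits t (x : leaf t -> nat -> bool) (v : leaf t -> nat) : counts t :=
  fun l => ((\sum_(j < v l) x l j)%N, (\sum_(j < v l) ~~ x l j)%N).

Lemma sum_boolC (b : nat -> bool) n :
  (\sum_(j < n) b j + \sum_(j < n) ~~ b j)%N = n.
Proof.
rewrite -big_split/= (eq_bigr (fun=> 1%N)) ?sum1_card ?card_ord//.
by move=> j _; case: (b j).
Qed.

Lemma trials_after_visits t x (v : leaf t -> nat) :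
  trials (after_visits x v) = (\sum_l v l)%N.
Proof. by apply: eq_bigr => l _; exact: sum_boolC. Qed.

Lemma posterior_full_support t (s : counts t) :
  regular t -> full_unit_support (posterior s).
Proof.
elim: t s => [f a|k n c IH] s reg.
  by apply: leaf_posterior_full_support => p; exact: (reg tt).2.
apply: node_posterior_full_support => i; apply: IH.
exact: regular_child reg.
Qed.

Lemma minimax01 t : regular t -> 0 <= minimax t <= 1.
Proof.
elim: t => [f a|k n c IH] reg.
  by have [/andP[a0 a1] _] := reg tt; rewrite !ltW.
have c01 i : 0 <= minimax (c i) <= 1.
  by apply: IH; exact: regular_child reg.
have c0 i : 0 <= minimax (c i) by case/andP: (c01 i).
have c1 i : minimax (c i) <= 1 by case/andP: (c01 i).
case: k {reg} => /=; apply/andP; split.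
- by apply: (le_trans (c0 ord0)); exact: le_bigmax.
- by apply: bigmax_le.
- by apply: le_bigmin.
- by apply: le_trans (c1 ord0); exact: bigmin_le.
Qed.

Lemma posterior_concentrates t x (v : nat -> leaf t -> nat) :
  regular t -> typical x -> (forall l, v m l @[m --> \oo] --> \oo) ->
  concentrates (fun m => posterior (after_visits x (v m))) (minimax t).
Proof.
elim: t x v => [f a|k n c IH] x v reg typ voo.
  have [a01 f_gt0] := reg tt.
  apply: leaf_posterior_concentrates => //=.
    by under eq_fun do rewrite sum_boolC; exact: voo.
  under eq_fun do rewrite sum_boolC.
  (* The frequency is evaluated along visit counts that tend to infinity. *)
  exact: (cvg_comp _ _ (voo tt) (typ tt)).
have := @node_posterior_concentrates R k n
  (fun i m => posterior (child_counts (after_visits x (v m)) i))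
  (fun i => minimax (c i)).
have cconc i : concentrates
    (fun m => posterior (child_counts (after_visits x (v m)) i)) (minimax (c i)).
  apply: (IH i (x \o child_leaf k i) (fun m => v m \o child_leaf k i)).
  - exact: regular_child reg.
  - exact: typical_child typ.
  - by move=> l; exact: voo.
by case: k x v {reg typ voo} cconc => x v cconc; apply.
Qed.

Lemma interior_posteriors_weak_cvg t x (v : nat -> leaf t -> nat) :
  regular t -> typical x -> (forall l, v m l @[m --> \oo] --> \oo) ->
  forall u : interior_node t,
  weak_cvg (fun m => posterior (node_counts (after_visits x (v m)) u))
    (dirac (minimax (subtree u) : measurableTypeR R)).
Proof.
elim: t x v => [f a|k n c IH] x v reg typ voo; first by case.
case => [[i u]|]; last first.
  exact: (concentrates_weak_cvg (posterior_concentrates reg typ voo)).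
apply: (IH i (x \o child_leaf k i) (fun m => v m \o child_leaf k i)).
- exact: regular_child reg.
- exact: typical_child typ.
- by move=> l; exact: voo.
Qed.

(* The counts may stay put, so that the restriction of a run to a subtree is
   again a run. *)
Definition policy_run t (x : leaf t -> nat -> bool) (v : nat -> leaf t -> nat) :=
  forall m, v m.+1 = v m \/ exists2 l, bayes_uct2 (after_visits x (v m)) l &
    v m.+1 = (fun l' => v m l' + (l == l'))%N.

(** A bounded nondecreasing sequence of naturals attains its maximum and stays there. *)
Lemma nd_cvgn_or_stationary (N : nat -> nat) : (forall m, (N m <= N m.+1)%N) ->
  N m @[m --> \oo] --> \oo \/ exists M, forall m, (M <= m)%N -> N m = N M.
Proof.
move=> ndN; have mono m m' : (m <= m')%N -> (N m <= N m')%N.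
  move=> /subnKC <-; elim: (m' - m)%N => [|p IH]; first by rewrite addn0.
  by rewrite addnS; exact: leq_trans IH (ndN _).
have [[B NB]|unb] := pselect (exists B, forall m, (N m <= B)%N).
  right; have exN : exists b, `[< exists m, N m = b >] by exists (N 0%N); apply/asboolP; exists 0%N.
  have bN b : `[< exists m, N m = b >] -> (b <= B)%N by move=> /asboolP[m <-].
  case: (ex_maxnP exN bN) => b /asboolP[M NM] maxb; exists M => m Mm.
  apply/eqP; rewrite eqn_leq (mono _ _ Mm) NM andbT.
  by apply: maxb; apply/asboolP; exists m.
left; apply/cvgnyPge => B.
have [m Bm] : exists m, (B < N m)%N.
  apply: contrapT => nB; apply: unb; exists B => m.
  by rewrite leqNgt; apply/negP => ?; apply: nB; exists m.
exists m => // m' /= mm'; exact: leq_trans (ltnW Bm) (mono _ _ mm').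
Qed.

(** A step either changes no count or raises the total by exactly 1, so a constant total means
    constant counts. *)
Lemma policy_run_stationary t x (v : nat -> leaf t -> nat) : policy_run x v ->
  (\sum_l v m l)%N @[m --> \oo] --> \oo \/
  exists M, forall m, (M <= m)%N -> v m = v M.
Proof.
move=> run; have step m : v m.+1 = v m \/ (\sum_l v m.+1 l = (\sum_l v m l).+1)%N.
  have [|[l _ ->]] := run m; [by left|right].
  rewrite big_split/= -addn1; congr addn.
  by rewrite (bigD1 l)//= eqxx big1// => l' /negbTE; rewrite eq_sym => ->.
have nd m : (\sum_l v m l <= \sum_l v m.+1 l)%N by case: (step m) => ->.
case: (nd_cvgn_or_stationary nd) => [|[M NM]]; [by left|right].
exists M; elim=> [|m IH]; first by rewrite leqn0 => /eqP ->.
rewrite leq_eqVlt => /orP[/eqP -> //|]; rewrite ltnS => Mm.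
rewrite -(IH Mm); case: (step m) => // /eqP.
by rewrite !NM ?(leqW Mm)// -[X in X == _]addn0 -addn1 eqn_add2l.
Qed.

(** A trial through another child is a pause for child [i]; a trial through [i] obeys the policy
    below it by the recursive clause of [bayes_uct2]. *)
Lemma child_policy_run k n (c : 'I_n.+1 -> tree R) i x v :
  @policy_run (Node k n c) x v ->
  policy_run (x \o child_leaf k i) (fun m => v m \o child_leaf k i).
Proof.
move=> run m; have [vm|[[j l] [_ /= bl] vm]] := run m.
  by left; rewrite vm.
have [ji|ji] := eqVneq j i; last first.
  left; apply/funext => l' /=; rewrite vm.
  rewrite [X in (_ + X)%N](_ : _ = 0%N) ?addn0//; apply/eqP; rewrite eqb0.
  by apply: contra ji => /eqP[/eqP].
move: l bl vm; rewrite ji => l bl vm.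
right; exists l => //; apply/funext => l' /=; rewrite vm; congr (_ + nat_of_bool _)%N.
by rewrite /child_leaf eq_sym [RHS]eq_sym eq_Tagged.
Qed.

Lemma sum_child_leaf k n (c : 'I_n.+1 -> tree R) (v : leaf (Node k n c) -> nat) :
  (\sum_l v l = \sum_(i < n.+1) \sum_l v (child_leaf k i l))%N.
Proof.
rewrite (sig_big_dep _ (fun=> predT) (fun i l => v (child_leaf k i l)))/=.
by apply: eq_bigr => -[].
Qed.

(** Once [u m] exceeds [exp (K ^+ 2)], its logarithm exceeds [K ^+ 2]. *)
Lemma exploration_cvgy (u : nat -> nat) : u m @[m --> \oo] --> \oo ->
  Num.sqrt (2 * ln (u m)%:R : R) @[m --> \oo] --> +oo.
Proof.
move=> uoo; apply/cvgryPge => K.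
have /cvgryPge/(_ (expR (K ^+ 2))) : ((u m)%:R : R) @[m --> \oo] --> +oo.
  exact/cvgrnyP.
apply: filterS => m Kum.
have um0 : 0 < (u m)%:R :> R by exact: lt_le_trans (expR_gt0 _) Kum.
have K2 : K ^+ 2 <= ln (u m)%:R.
  by rewrite -[leLHS]expRK ler_ln// posrE expR_gt0.
apply: (le_trans (ler_norm K)); rewrite -sqrtr_sqr ler_wsqrtr//.
by have := sqr_ge0 K; lra.
Qed.

Lemma visits_cvgy t x (v : nat -> leaf t -> nat) :
  regular t -> typical x -> policy_run x v ->
  (\sum_l v m l)%N @[m --> \oo] --> \oo ->
  forall l, v m l @[m --> \oo] --> \oo.
Proof.
elim: t x v => [f a|k n c IH] x v reg typ run voo.
  case; suff -> : (fun m => v m tt) = (fun m => (\sum_l v m l)%N) by [].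
  by apply/funext => m; rewrite (bigD1 tt)//= big1 ?addn0//; case.
pose vc i m := v m \o child_leaf k i.
pose N i m := (\sum_l vc i m l)%N.
have runc i : policy_run (x \o child_leaf k i) (vc i) by exact: child_policy_run.
have sumN m : (\sum_l v m l = \sum_i N i m)%N by exact: sum_child_leaf.
suff Noo i : N i m @[m --> \oo] --> \oo.
  move=> [i l]; apply: (IH i (x \o child_leaf k i) (vc i)) => //.
  - exact: regular_child reg.
  - exact: typical_child typ.
  - exact: Noo.
have [|[M vM]] := policy_run_stationary (runc i); first by [].
exfalso.
(* Otherwise all children would be stationary after the largest of their stopping times, and so
   would the total. *)
have [j Nj] : exists j, N j m @[m --> \oo] --> \oo.
  apply: contrapT => nN.
  have stat j : exists M, forall m, (M <= m)%N -> vc j m = vc j M.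
    by have [Nj|] := policy_run_stationary (runc j) => //; exfalso; apply: nN; exists j.
  have [Mf HMf] := choice stat.
  pose M' := (\max_j Mf j)%N.
  have MfM j : (Mf j <= M')%N by exact: leq_bigmax.
  have /cvgnyPge/(_ (\sum_l v M' l).+1)[m0 _ /(_ (maxn m0 M') (leq_maxl _ _))] := voo.
  suff -> : (\sum_l v (maxn m0 M') l = \sum_l v M' l)%N by rewrite /= ltnn.
  rewrite !sumN; apply: eq_bigr => j _; rewrite /N.
  apply: eq_bigr => l _; rewrite !(HMf j)//.
  exact: leq_trans (MfM j) (leq_maxr _ _).
pose post j m := posterior (after_visits (x \o child_leaf k j) (vc j m)).
have postj : full_unit_support (post i M).
  exact/posterior_full_support/regular_child/reg.
have sj : stddev (post j m) @[m --> \oo] --> (0 : R).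
  apply: (@stddev_cvg0 _ _ (minimax (c j))).
  - exact/minimax01/regular_child/reg.
  - by move=> m; exact/posterior_full_support/regular_child/reg.
  - apply: posterior_concentrates.
    + exact: regular_child reg.
    + exact: typical_child typ.
    + apply: IH => //; [exact: regular_child reg|exact: typical_child typ].
have s0 := stddev_gt0 postj; set s := stddev _ in s0.
pose sq m : R := Num.sqrt (2 * ln (\sum_l v m l)%:R).
have [M1 M1P] : exists M1, forall m, (M1 <= m)%N ->
    [/\ (M <= m)%N, (0 < \sum_l v m l)%N, 4 / s <= sq m & stddev (post j m) <= s / 2].
  have : \forall m \near \oo, [/\ (M <= m)%N, (0 < \sum_l v m l)%N,
      4 / s <= sq m & stddev (post j m) <= s / 2].
    near=> m; split; near: m.
    - exact: nbhs_infty_ge.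
    - exact: (voo _ (nbhs_infty_gt 0)).
    - have /cvgryPge := exploration_cvgy voo; exact.
    - have /cvgrPdist_le/(_ (s / 2)) := sj; rewrite divr_gt0// => /(_ isT).
      by apply: filterS => m; rewrite sub0r normrN; apply: le_trans; exact: ler_norm.
  by move=> [M1 _ H]; exists M1 => m; exact: H.
have Nstat m : (M1 <= m)%N -> N j m = N j M1.
  elim: m => [|m IHm]; first by rewrite leqn0 => /eqP ->.
  rewrite leq_eqVlt => /orP[/eqP -> //|]; rewrite ltnS => M1m.
  rewrite -(IHm M1m); have [vm|[[j' l] [/= best _] vm]] := run m.
    by rewrite /N /vc vm.
  have [jj'|j'j] := eqVneq j' j; last first.
    apply: eq_bigr => l' _; rewrite /vc/= vm.
    rewrite [X in (_ + X)%N](_ : _ = 0%N) ?addn0//; apply/eqP; rewrite eqb0.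
    by apply: contra j'j => /eqP[/eqP].
  exfalso; have [Mm v0 sqm sjm] := M1P m M1m.
  have sumT : (\sum_(j < n.+1) trials (child_counts (after_visits x (v m)) j) =
      \sum_l v m l)%N.
    by rewrite sumN; apply: eq_bigr => i' _; exact: (@trials_after_visits _ (x \o child_leaf k i')).
  have := best _ i; rewrite sumT => /(_ v0).
  rewrite /bayes_uct2_score sumT -/(sq m) jj'.
  (* The counts of child [i] have not moved since time [M]. *)
  rewrite [posterior _](_ : _ = post i M); last first.
    by rewrite /post -(vM m Mm).
  rewrite -/s [posterior _](_ : _ = post j m)//.
  have /andP[m0 _] := mean01 postj.
  have /andP[_ m1] : 0 <= mean (post j m) <= 1.
    by apply: mean01; exact/posterior_full_support/regular_child/reg.
  have sq0 : 0 <= sq m by exact: sqrtr_ge0.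
  move: sqm; rewrite ler_pdivrMr// => sqm.
  have : sq m * stddev (post j m) <= sq m * (s / 2) by exact: ler_wpM2l.
  by lra.
have /cvgnyPge/(_ (N j M1).+1)[m0 _ /(_ (maxn m0 M1) (leq_maxl _ _))] := Nj.
by rewrite /= Nstat ?ltnn// leq_maxr.
Unshelve. all: by end_near. Qed.

End observations.

Theorem theorem2 (R : realType) (d : measure_display) (T : measurableType d)
    (P : probability T R) (t : tree R)
    (X : leaf t -> nat -> {RV P >-> bool}) (A : T -> nat -> leaf t)
    (win_rate01 : forall l : leaf t, 0 < win_rate l < 1)
    (prior_gt0 : forall (l : leaf t) (p : R), 0 < p < 1 -> 0 < leaf_prior l p)
    (prior_derivable : forall (l : leaf t) (p : R), 0 < p < 1 ->
      derivable (leaf_prior l) p 1)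
    (prior_derive_bounded : forall l : leaf t, exists M : R,
      forall p : R, 0 < p < 1 -> `|derive1 (leaf_prior l) p| <= M)
    (siblings : distinct_siblings t)
    (payoff_win_rate : forall (l : leaf t) (j : nat),
      P (X l j @^-1` [set true]) = (win_rate l)%:E)
    (payoff_independent :
      mutually_independent (fun lj : leaf t * nat => X lj.1 lj.2))
    (policy : forall (w : T) (m : nat),
      bayes_uct2 (observed (fun l j => X l j w) (A w) m) (A w m)) :
  {ae P, forall w : T, forall v : interior_node t,
    weak_cvg
      (fun m => posterior
         (node_counts (observed (fun l j => X l j w) (A w) m) v))
      (dirac (minimax (subtree v) : measurableTypeR R))}.
Proof.
have : {ae P, forall w, forall l : leaf t,
    (\sum_(j < n) X l j w)%:R / n%:R @[n --> \oo] --> win_rate l}.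
  (* There are finitely many leaves, so the almost sure events can be intersected. *)
  apply: filter_forall => l; apply: strong_law_bernoulli => //.
  move=> J B uJ mB.
  (* Joint independence is restricted to the samples of the single leaf [l]. *)
  have := payoff_independent [seq (l, j) | j <- J] (fun lj => B lj.2).
  rewrite map_inj_uniq; last by move=> j j' [].
  move=> /(_ uJ (fun lj => mB lj.2)); rewrite big_map /= => <-; congr (P _).
  apply/seteqP; split => w XB.
    by move=> lj /= /mapP[j jJ ->]; exact: XB.
  by move=> j /= jJ; apply: (XB (l, j)); exact: map_f.
apply: filterS => w typ.
have reg : regular t by move=> l; split; [exact: win_rate01|exact: prior_gt0].
pose visits m l := (\sum_(j < m) (A w j == l))%N.
apply: (@interior_posteriors_weak_cvg _ _ _ visits reg typ).
apply: (visits_cvgy reg typ).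
  move=> m; right; exists (A w m); first exact: policy.
  by apply/funext => l; rewrite /visits big_ord_recr.
(* Each trial visits exactly one leaf, so the total after [m] trials is [m]. *)
suff -> : (fun m => (\sum_l visits m l)%N) = id by exact: cvg_id.
apply/funext => m; rewrite exchange_big/= (eq_bigr (fun=> 1%N)).
  by rewrite sum1_card card_ord.
by move=> j _; rewrite (bigD1 (A w j))//= eqxx big1// => l /negbTE; rewrite eq_sym => ->.
Qed.
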